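(* Let $n\geq 4$ and let $\delta: VT_n\to\mathrm{GL}_{n+1}(\mathbb{C})$ be a homogeneous $3$-local representation of the virtual twin group $VT_n$. Then $\delta$ is equivalent to one of the fourteen representations $\delta_j$, $1\leq j\leq 14$, defined by $\delta_j(s_i)=\mathrm{diag}(I_{i-1},M_j,I_{n-i-1})$ and $\delta_j(\rho_i)=\mathrm{diag}(I_{i-1},N_j,I_{n-i-1})$ for all $1\leq i\leq n-1$, where: (1) $M_1=\begin{pmatrix}1&0&0\\0&e&\frac{1-e^2}{h}\\0&h&-e\end{pmatrix}$, $N_1=\begin{pmatrix}1&0&0\\0&0&p\\0&\frac1p&0\end{pmatrix}$, $e\in\mathbb{C}$, $h,p\in\mathbb{C}^*$; (2) $M_2=\begin{pmatrix}-e&\frac{1-e^2}{d}&0\\d&e&0\\0&0&1\end{pmatrix}$, $N_2=\begin{pmatrix}0&k&0\\\frac1k&0&0\\0&0&1\end{pmatrix}$, $e\in\mathbb{C}$, $d,k\in\mathbb{C}^*$; (3) $M_3=\begin{pmatrix}1&0&0\\d&-1&2p-dp^2\\0&0&1\end{pmatrix}$, $N_3=\begin{pmatrix}1&0&0\\\frac1p&-1&p\\0&0&1\end{pmatrix}$, $d\in\mathbb{C}$, $p\in\mathbb{C}^*$; (4) $M_4=\begin{pmatrix}1&2k-hk^2&0\\0&-1&0\\0&h&1\end{pmatrix}$, $N_4=\begin{pmatrix}1&k&0\\0&-1&0\\0&\frac1k&1\end{pmatrix}$, $h\in\mathbb{C}$, $k\in\mathbb{C}^*$; (5) $M_5=\begin{pmatrix}1&b&0\\0&-1&0\\0&0&1\end{pmatrix}$,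 $N_5=\begin{pmatrix}0&k&0\\\frac1k&0&0\\0&0&1\end{pmatrix}$, $b\in\mathbb{C}$, $k\in\mathbb{C}^*$; (6) $M_6=\begin{pmatrix}-1&b&0\\0&1&0\\0&0&1\end{pmatrix}$, $N_6=\begin{pmatrix}0&k&0\\\frac1k&0&0\\0&0&1\end{pmatrix}$, $b\in\mathbb{C}$, $k\in\mathbb{C}^*$; (7) $M_7=I_3$, $N_7=\begin{pmatrix}1&0&0\\\frac1p&-1&p\\0&0&1\end{pmatrix}$, $p\in\mathbb{C}^*$; (8) $M_8=I_3$, $N_8=\begin{pmatrix}1&k&0\\0&-1&0\\0&\frac1k&1\end{pmatrix}$, $k\in\mathbb{C}^*$; (9) $M_9=\mathrm{diag}(1,-1,-1)$, $N_9=\begin{pmatrix}1&0&0\\0&0&p\\0&\frac1p&0\end{pmatrix}$, $p\in\mathbb{C}^*$; (10) $M_{10}=\mathrm{diag}(1,-1,1)$, $N_{10}=\begin{pmatrix}1&0&0\\0&0&p\\0&\frac1p&0\end{pmatrix}$, $p\in\mathbb{C}^*$; (11) $M_{11}=I_3$, $N_{11}=\begin{pmatrix}1&0&0\\0&0&p\\0&\frac1p&0\end{pmatrix}$, $p\in\mathbb{C}^*$; (12) $M_{12}=\mathrm{diag}(-1,-1,1)$, $N_{12}=\begin{pmatrix}0&k&0\\\frac1k&0&0\\0&0&1\end{pmatrix}$, $k\in\mathbb{C}^*$; (13) $M_{13}=I_3$, $N_{13}=\begin{pmatrix}0&k&0\\\frac1k&0&0\\0&0&1\end{pmatrix}$,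 $k\in\mathbb{C}^*$; (14) $M_{14}=I_3$, $N_{14}=I_3$.
   Context: The virtual twin group $VT_n$ ($n\geq 2$) has generators $s_1,\dots,s_{n-1},\rho_1,\dots,\rho_{n-1}$ and defining relations: $s_i^2=1$ ($1\le i\le n-1$); $s_is_j=s_js_i$ ($|i-j|\ge2$); $\rho_i\rho_{i+1}\rho_i=\rho_{i+1}\rho_i\rho_{i+1}$ ($1\le i\le n-2$); $\rho_i\rho_j=\rho_j\rho_i$ ($|i-j|\ge2$); $\rho_i^2=1$ ($1\le i\le n-1$); $s_i\rho_j=\rho_js_i$ ($|i-j|\ge2$); $\rho_i\rho_{i+1}s_i=s_{i+1}\rho_i\rho_{i+1}$ ($1\le i\le n-2$). A representation $\delta:VT_n\to\mathrm{GL}_{n+1}(\mathbb{C})$ is homogeneous $3$-local if there are fixed $M,N\in\mathrm{GL}_3(\mathbb{C})$ with $\delta(s_i)=\mathrm{diag}(I_{i-1},M,I_{n-i-1})$ and $\delta(\rho_i)=\mathrm{diag}(I_{i-1},N,I_{n-i-1})$ for all $1\le i\le n-1$, where $\mathrm{diag}$ denotes block-diagonal matrices and $I_r$ the $r\times r$ identity. $\mathbb{C}^*=\mathbb{C}\setminus\{0\}$. Equivalent means conjugate by an invertible matrix. *)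

(* Defs.v *)
(* The complex numbers are C := complex R (= R[i]) over
   Stdlib's real numbers R, which is a realType (hence rcfType) via Rstruct. *)
From HB Require Import structures.
From mathcomp Require Import all_boot all_order all_algebra.
From mathcomp Require Import complex.
From mathcomp Require Import Rstruct.
Set Implicit Arguments. Unset Strict Implicit. Unset Printing Implicit Defensive.
Import Order.TTheory GRing.Theory Num.Theory.
Local Open Scope ring_scope.

Notation C := (complex Rdefinitions.R).

Definition mx3 (a b c d e f g h k : C) : 'M[C]_3 :=
  \matrix_(i < 3, j < 3)
    nth 0 (nth [::] [:: [:: a; b; c]; [:: d; e; f]; [:: g; h; k]] i) j.

(* localmx n i X = diag(I_{i-1}, X, I_{n-i-1}) in M_{n+1}(C), for 1 <= i <= n-1:
   the block X occupies (1-based) rows/columns i, i+1, i+2, i.e. 0-based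
   indices i-1, i, i+1. *)
Definition localmx (n i : nat) (X : 'M[C]_3) : 'M[C]_(n.+1) :=
  \matrix_(a < n.+1, b < n.+1)
    if (i.-1 <= a < i.+2)%N && (i.-1 <= b < i.+2)%N
    then X (inord (a - i.-1)) (inord (b - i.-1))
    else (a == b)%:R.

Definition far (i j : nat) : bool := (i.+2 <= j)%N || (j.+2 <= i)%N.

(* The assignment s_i |-> localmx n i M, rho_i |-> localmx n i N (1<=i<=n-1)
   satisfies all defining relations of VT_n, i.e. it defines a (homogeneous
   3-local) representation VT_n -> GL_{n+1}(C). *)
Definition VT_rep_relations (n : nat) (M N : 'M[C]_3) : Prop :=
  let S := fun i => localmx n i M in
  let P := fun i => localmx n i N in
  (forall i, (1 <= i <= n.-1)%N -> S i *m S i = 1%:M) /\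
      (forall i j, (1 <= i <= n.-1)%N -> (1 <= j <= n.-1)%N -> far i j ->
          S i *m S j = S j *m S i) /\
      (forall i, (1 <= i <= n - 2)%N ->
          P i *m P i.+1 *m P i = P i.+1 *m P i *m P i.+1) /\
      (forall i j, (1 <= i <= n.-1)%N -> (1 <= j <= n.-1)%N -> far i j ->
          P i *m P j = P j *m P i) /\
      (forall i, (1 <= i <= n.-1)%N -> P i *m P i = 1%:M) /\
      (forall i j, (1 <= i <= n.-1)%N -> (1 <= j <= n.-1)%N -> far i j ->
          S i *m P j = P j *m S i) /\
      (forall i, (1 <= i <= n - 2)%N ->
          P i *m P i.+1 *m S i = S i.+1 *m P i *m P i.+1).

Definition homogeneous_3_local_rep (n : nat) (M N : 'M[C]_3) : Prop :=
  M \in unitmx /\ N \in unitmx /\ VT_rep_relations n M N.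

Definition M1 (e h : C) := mx3 1 0 0  0 e ((1 - e ^+ 2) / h)  0 h (- e).
Definition N1 (p : C) := mx3 1 0 0  0 0 p  0 p^-1 0.
Definition M2 (e d : C) := mx3 (- e) ((1 - e ^+ 2) / d) 0  d e 0  0 0 1.
Definition N2 (k : C) := mx3 0 k 0  k^-1 0 0  0 0 1.
Definition M3 (d p : C) := mx3 1 0 0  d (-1) (2 * p - d * p ^+ 2)  0 0 1.
Definition N3 (p : C) := mx3 1 0 0  p^-1 (-1) p  0 0 1.
Definition M4 (h k : C) := mx3 1 (2 * k - h * k ^+ 2) 0  0 (-1) 0  0 h 1.
Definition N4 (k : C) := mx3 1 k 0  0 (-1) 0  0 k^-1 1.
Definition M5 (b : C) := mx3 1 b 0  0 (-1) 0  0 0 1.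
Definition M6 (b : C) := mx3 (-1) b 0  0 1 0  0 0 1.
Definition I3 : 'M[C]_3 := mx3 1 0 0  0 1 0  0 0 1.
Definition M9 : 'M[C]_3 := mx3 1 0 0  0 (-1) 0  0 0 (-1).
Definition M10 : 'M[C]_3 := mx3 1 0 0  0 (-1) 0  0 0 1.
Definition M12 : 'M[C]_3 := mx3 (-1) 0 0  0 (-1) 0  0 0 1.

Definition delta_family (M' N' : 'M[C]_3) : Prop :=
  (exists e h p : C, [/\ h != 0, p != 0, M' = M1 e h & N' = N1 p]) \/
      (exists e d k : C, [/\ d != 0, k != 0, M' = M2 e d & N' = N2 k]) \/
      (exists d p : C, [/\ p != 0, M' = M3 d p & N' = N3 p]) \/
      (exists h k : C, [/\ k != 0, M' = M4 h k & N' = N4 k]) \/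
      (exists b k : C, [/\ k != 0, M' = M5 b & N' = N2 k]) \/
      (exists b k : C, [/\ k != 0, M' = M6 b & N' = N2 k]) \/
      (exists p : C, [/\ p != 0, M' = I3 & N' = N3 p]) \/
      (exists k : C, [/\ k != 0, M' = I3 & N' = N4 k]) \/
      (exists p : C, [/\ p != 0, M' = M9 & N' = N1 p]) \/
      (exists p : C, [/\ p != 0, M' = M10 & N' = N1 p]) \/
      (exists p : C, [/\ p != 0, M' = I3 & N' = N1 p]) \/
      (exists k : C, [/\ k != 0, M' = M12 & N' = N2 k]) \/
      (exists k : C, [/\ k != 0, M' = I3 & N' = N2 k]) \/
      (M' = I3 /\ N' = I3).

(* Main.v *)
Require Import Defs.
From HB Require Import structures.
From mathcomp Require Import all_boot all_order all_algebra.
From mathcomp Require Import complex Rstruct.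
From mathcomp Require Import fingroup perm ring zify.
Set Implicit Arguments. Unset Strict Implicit. Unset Printing Implicit Defensive.
Import Order.TTheory GRing.Theory Num.Theory.
Local Open Scope ring_scope.

(** The blocks at positions 1 and 3 overlap in a single basis vector, so the far
    commutations say that products of entries of [M - I] and [N - I] taken from
    the rows and columns meeting there vanish.  Together with the involution and
    braid relations they force [N] to be [I], [N1], [N2], [N3] or [N4]; the far
    commutations between [M] and [N], [M^2 = I] and the mixed relation then
    determine [M].  No conjugation is needed except for [N1] with [M] upper
    triangular, where the cyclic shift of the basis moves the 2x2 blocks from the
    last two to the first two coordinates and yields [M5] or [M6] with [N2]. *)

(** * The relations in terms of entries, over a field *)

Section Algebra.
Variable F : fieldType.
Implicit Types x y : nat -> nat -> F.

(* [nat]-indexed counterpart of [localmx], over an arbitrary field. *)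
Definition nloc (i : nat) x (a b : nat) : F :=
  if (i.-1 <= a < i.+2)%N && (i.-1 <= b < i.+2)%N
  then x (a - i.-1)%N (b - i.-1)%N else (a == b)%:R.

(* Product of the upper left 5x5 corners. *)
Definition nmul x y (a b : nat) : F :=
  x a 0%N * y 0%N b + x a 1%N * y 1%N b + x a 2%N * y 2%N b
  + x a 3%N * y 3%N b + x a 4%N * y 4%N b.

(** The blocks at positions 1, 2 and 3 only meet indices below 5, so this corner shows every
    relation used below. *)
Definition eq5 x y := forall a b : nat, (a < 5)%N -> (b < 5)%N -> x a b = y a b.

(** Packing the nine entries in a tuple makes a whole block one equation, which injection splits
    again. *)
Definition entries x :=
  (x 0%N 0%N, x 0%N 1%N, x 0%N 2%N, x 1%N 0%N, x 1%N 1%N, x 1%N 2%N,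
   x 2%N 0%N, x 2%N 1%N, x 2%N 2%N).

Definition commutes_far x y :=
  eq5 (nmul (nloc 1 x) (nloc 3 y)) (nmul (nloc 3 y) (nloc 1 x)).
Definition involutive_loc x := eq5 (nmul (nloc 1 x) (nloc 1 x)) (fun a b => (a == b)%:R).
Definition mixed x y :=
  eq5 (nmul (nmul (nloc 1 y) (nloc 2 y)) (nloc 1 x))
      (nmul (nmul (nloc 2 x) (nloc 1 y)) (nloc 2 y)).
Definition braid y :=
  eq5 (nmul (nmul (nloc 1 y) (nloc 2 y)) (nloc 1 y))
      (nmul (nmul (nloc 2 y) (nloc 1 y)) (nloc 2 y)).

(** A certificate: the goal is [c] times a known equation, up to an identity that [ring] or [field]
    settles. *)
Lemma eq_comb (c t u l r : F) : l = r -> t - u = c * (l - r) -> t = u.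
Proof. by move=> ->; rewrite subrr mulr0 => /eqP; rewrite subr_eq0 => /eqP. Qed.

Arguments eq_comb c {t u l r}.

Lemma double_inj (t u : F) : 2 != 0 :> F -> t + t = u + u -> t = u.
Proof. by move=> two Q; apply: (eq_comb 2^-1 Q); field. Qed.

Lemma double_eq0 (t : F) : 2 != 0 :> F -> t + t = 0 -> t = 0.
Proof. by move=> two t0; apply: (double_inj two); rewrite t0 addr0. Qed.

Definition simpr := (mul0r, mulr0, mul1r, mulr1, @add0r F, @addr0 F).

Ltac entry H p :=
  move: (H (fst p) (snd p) isT isT);
  rewrite /nmul /nloc /= ?(subSS, subn0, subnn) ?simpr.

(** Let A and B be the embedded blocks of [x] and [y] minus the identity; they meet only in index 2.
    At (i, j + 2) the product A B is the single term displayed below, while B A vanishes. At (i, j)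
    = (2, 0) the two products agree anyway, hence the exclusion. *)
Lemma far_row x y : commutes_far x y -> forall i j : nat, (i < 3)%N -> (j < 3)%N ->
  (i, j) != (2%N, 0%N) -> x i 2%N = (i == 2%N)%:R \/ y 0%N j = (j == 0%N)%:R.
Proof.
move=> H i j hi hj hij.
suff /eqP : (x i 2%N - (i == 2%N)%:R) * (y 0%N j - (j == 0%N)%:R) = 0.
  by rewrite mulf_eq0 !subr_eq0 => /orP[] /eqP; [left|right].
case: i j hi hj hij => [|[|[|//]]] [|[|[|//]]] // _ _ _ /=; rewrite !(subr0).
- by entry H (0, 2)%N => E; apply: (eq_comb 1 E); ring.
- by entry H (0, 3)%N => ->.
- by entry H (0, 4)%N => ->.
- by entry H (1, 2)%N => E; apply: (eq_comb 1 E); ring.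
- by entry H (1, 3)%N => ->.
- by entry H (1, 4)%N => ->.
- by entry H (2, 3)%N => E; apply: (eq_comb 1 E); ring.
- by entry H (2, 4)%N => E; apply: (eq_comb 1 E); ring.
Qed.

(** The transposed argument: at (j + 2, i) only B A contributes, again by a single term. *)
Lemma far_col x y : commutes_far x y -> forall i j : nat, (i < 3)%N -> (j < 3)%N ->
  (i, j) != (2%N, 0%N) -> x 2%N i = (i == 2%N)%:R \/ y j 0%N = (j == 0%N)%:R.
Proof.
move=> H i j hi hj hij.
suff /eqP : (x 2%N i - (i == 2%N)%:R) * (y j 0%N - (j == 0%N)%:R) = 0.
  by rewrite mulf_eq0 !subr_eq0 => /orP[] /eqP; [left|right].
case: i j hi hj hij => [|[|[|//]]] [|[|[|//]]] // _ _ _ /=; rewrite !(subr0).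
- by entry H (2, 0)%N => E; apply: (eq_comb (-1) E); ring.
- by entry H (3, 0)%N => E; apply: (eq_comb (-1) E); ring.
- by entry H (4, 0)%N => E; apply: (eq_comb (-1) E); ring.
- by entry H (2, 1)%N => E; apply: (eq_comb (-1) E); ring.
- by entry H (3, 1)%N => E; apply: (eq_comb (-1) E); ring.
- by entry H (4, 1)%N => E; apply: (eq_comb (-1) E); ring.
- by entry H (3, 2)%N => E; apply: (eq_comb (-1) E); ring.
- by entry H (4, 2)%N => E; apply: (eq_comb (-1) E); ring.
Qed.

(** * Classification of [N] *)

Lemma braid2 (e f h k : F) :
  e * e + f * h = 1 -> e * f + f * k = 0 -> h * e + k * h = 0 ->
  h * f + k * k = 1 -> e * e + f * e * h = e -> f * e * k = 0 -> k = h * f * k + k * k ->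
  (e = 1 /\ k = 1) \/ [/\ e = 0, k = 0, f != 0 & h = f^-1].
Proof.
move=> I11 I12 I21 I22 B1 B2 B3.
(* If [f * h = 0], the involution gives [e] and [k] square 1, while [B1] and [B3] make them
   idempotent. Otherwise [k = - e], and [B2] forces [e = 0], leaving an antidiagonal block. *)
have fh0 : f * h = 0 -> e = 1 /\ k = 1.
  move=> fh; split.
    by apply: etrans I11; rewrite fh addr0 -{1}B1 mulrAC fh mul0r addr0.
  by apply: etrans I22; rewrite [h * f]mulrC fh add0r {1}B3 [h * f]mulrC fh mul0r add0r.
have [f0|f0] := eqVneq f 0; first by left; apply: fh0; rewrite f0 mul0r.
have [h0|h0] := eqVneq h 0; first by left; apply: fh0; rewrite h0 mulr0.
right.
have ke : k = - e.
  have : f * (e + k) = 0 by rewrite -I12; ring.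
  by move/eqP; rewrite mulf_eq0 (negPf f0) addrC addr_eq0 => /eqP.
have e0 : e = 0.
  by move/eqP: B2; rewrite ke mulrN oppr_eq0 !mulf_eq0 (negPf f0) /= => /orP[] /eqP.
split=> //; first by rewrite ke e0 oppr0.
by apply: (mulfI f0); rewrite mulfV // -I11 e0 mul0r add0r.
Qed.

Definition is_N1 y p := entries y = (1, 0, 0, 0, 0, p, 0, p^-1, 0).
Definition is_N2 y p := entries y = (0, p, 0, p^-1, 0, 0, 0, 0, 1).
Definition is_N3 y p := entries y = (1, 0, 0, p^-1, -1, p, 0, 0, 1).
Definition is_N4 y p := entries y = (1, p, 0, 0, -1, 0, 0, p^-1, 1).
Definition is_I y := entries y = (1, 0, 0, 0, 1, 0, 0, 0, 1).

(** If [y 2 2] is not 1, far commutation clears row 0 off the diagonal. Then the (0, 0) entry has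
    square 1 by the involution and is idempotent by the braid relation, so it is 1. *)
Lemma far_corner y : commutes_far y y -> involutive_loc y -> braid y ->
  y 0%N 0%N = 1 \/ y 2%N 2%N = 1.
Proof.
move=> H I B.
have [->|a1] := eqVneq (y 0%N 0%N) 1; first by left.
have [->|k1] := eqVneq (y 2%N 2%N) 1; first by right.
have y01 : y 0%N 1%N = 0.
  by case: (@far_row y y H 2%N 1%N isT isT isT) => // /eqP; rewrite (negPf k1).
have y02 : y 0%N 2%N = 0.
  by case: (@far_row y y H 2%N 2%N isT isT isT) => // /eqP; rewrite (negPf k1).
entry I (0, 0)%N; entry B (0, 0)%N; rewrite y01 y02 ?simpr => -> /eqP.
by rewrite (negPf a1).
Qed.

Lemma braid_classification y : 2 != 0 :> F ->
  commutes_far y y -> involutive_loc y -> braid y ->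
  is_I y \/ exists2 p, p != 0 & [\/ is_N1 y p, is_N2 y p, is_N3 y p | is_N4 y p].
Proof.
move=> two H I B.
have R i j := @far_row y y H i j; have K i j := @far_col y y H i j.
(* A corner [y 2 2] other than 1 makes row 0 and column 0 trivial, leaving the lower right 2x2 block
   to [braid2]. *)
have [k1|k1] := eqVneq (y 2%N 2%N) 1; last first.
  have [a1|] := far_corner H I B; last by move/eqP; rewrite (negPf k1).
  have y01 : y 0%N 1%N = 0.
    by case: (R 2%N 1%N isT isT isT) => // /eqP; rewrite (negPf k1).
  have y02 : y 0%N 2%N = 0.
    by case: (R 2%N 2%N isT isT isT) => // /eqP; rewrite (negPf k1).
  have y10 : y 1%N 0%N = 0.
    by case: (K 2%N 1%N isT isT isT) => // /eqP; rewrite (negPf k1).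
  have y20 : y 2%N 0%N = 0.
    by case: (K 2%N 2%N isT isT isT) => // /eqP; rewrite (negPf k1).
  have E := (a1, y01, y02, y10, y20, simpr).
  have [] := @braid2 (y 1 1)%N (y 1 2)%N (y 2 1)%N (y 2 2)%N.
  - by entry I (1, 1)%N; rewrite ?E.
  - by entry I (1, 2)%N; rewrite ?E.
  - by entry I (2, 1)%N; rewrite ?E.
  - by entry I (2, 2)%N; rewrite ?E.
  - by entry B (1, 1)%N; rewrite ?E => Q; apply: (eq_comb 1 Q); ring.
  - by entry B (1, 2)%N; rewrite ?E => Q; apply: (eq_comb 1 Q); ring.
  - by entry B (3, 3)%N; rewrite ?E => Q; apply: (eq_comb 1 Q); ring.
  - by case=> _ /eqP; rewrite (negPf k1).
  case=> y11 y22 y12 y21; right; exists (y 1 2)%N => //.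
  by apply: Or41; rewrite /is_N1 /entries !E y11 y22 y21.
(* Mirror case: row 2 and column 2 are trivial and the upper left block remains. *)
have [a1|a1] := eqVneq (y 0%N 0%N) 1; last first.
  have y02 : y 0%N 2%N = 0.
    by case: (R 0%N 0%N isT isT isT) => // /eqP; rewrite (negPf a1).
  have y12 : y 1%N 2%N = 0.
    by case: (R 1%N 0%N isT isT isT) => // /eqP; rewrite (negPf a1).
  have y20 : y 2%N 0%N = 0.
    by case: (K 0%N 0%N isT isT isT) => // /eqP; rewrite (negPf a1).
  have y21 : y 2%N 1%N = 0.
    by case: (K 1%N 0%N isT isT isT) => // /eqP; rewrite (negPf a1).
  have E := (k1, y02, y12, y20, y21, simpr).
  have [] := @braid2 (y 0 0)%N (y 0 1)%N (y 1 0)%N (y 1 1)%N.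
  - by entry I (0, 0)%N; rewrite ?E.
  - by entry I (0, 1)%N; rewrite ?E.
  - by entry I (1, 0)%N; rewrite ?E.
  - by entry I (1, 1)%N; rewrite ?E.
  - by entry B (0, 0)%N; rewrite ?E => Q; apply: (eq_comb 1 Q); ring.
  - by entry B (0, 1)%N; rewrite ?E => Q; apply: (eq_comb 1 Q); ring.
  - by entry B (2, 2)%N; rewrite ?E => Q; apply: (eq_comb 1 Q); ring.
  - by case=> /eqP; rewrite (negPf a1).
  case=> y00 y11 y01 y10; right; exists (y 0 1)%N => //.
  by apply: Or42; rewrite /is_N2 /entries !E y00 y11 y10.
(* Both corners are now 1. The two alternatives of the far relation coincide here: it says that the
   square of this entry is 0. *)
have y02 : y 0%N 2%N = 0 by case: (R 0%N 2%N isT isT isT).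
have y20 : y 2%N 0%N = 0 by case: (K 0%N 2%N isT isT isT).
have E := (a1, k1, y02, y20, simpr).
have bd : (y 0 1)%N * (y 1 0)%N = 0.
  by entry I (0, 0)%N; rewrite ?E => Q; apply: (eq_comb 1 Q); ring.
have fh : (y 2 1)%N * (y 1 2)%N = 0.
  by entry I (2, 2)%N; rewrite ?E => Q; apply: (eq_comb 1 Q); ring.
have : (y 1 1)%N * (y 1 1)%N = 1.
  by entry I (1, 1)%N; rewrite ?E [_ * (y 0 1)%N]mulrC bd [_ * (y 2 1)%N]mulrC fh !simpr.
move/eqP; rewrite -expr2 sqrf_eq1 => /orP[] /eqP e1.
  have y01 : (y 0 1)%N = 0 by apply: (double_eq0 two); entry I (0, 1)%N; rewrite ?E e1 ?simpr.
  have y10 : (y 1 0)%N = 0 by apply: (double_eq0 two); entry I (1, 0)%N; rewrite ?E e1 ?simpr.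
  have y12 : (y 1 2)%N = 0 by apply: (double_eq0 two); entry I (1, 2)%N; rewrite ?E e1 ?simpr.
  have y21 : (y 2 1)%N = 0 by apply: (double_eq0 two); entry I (2, 1)%N; rewrite ?E e1 ?simpr.
  by left; rewrite /is_I /entries !E e1 y01 y10 y12 y21.
(* Let b, d, f, h be the entries (0, 1), (1, 0), (1, 2), (2, 1). With middle entry -1 and b d = f h
   = 0, the (1, 1) entry of the braid relation becomes 2 (b h + d f) = 2. A nonzero b leads to
   [is_N4]; b = 0 forces d f = 1 and leads to [is_N3]. *)
right.
have [b0|b0] := eqVneq (y 0 1)%N 0; last first.
  have y12 : (y 1 2)%N = 0.
    by case: (R 1%N 1%N isT isT isT) => //= /eqP; rewrite (negPf b0).
  have y10 : (y 1 0)%N = 0.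
    by move/eqP: bd; rewrite mulf_eq0 (negPf b0) => /eqP.
  exists (y 0 1)%N => //; apply: Or44; rewrite /is_N4 /entries ?E e1 y12 y10.
  congr (_, _, _, _, _, _, _, _, _); apply: (mulfI b0); rewrite mulfV //.
  entry B (1, 1)%N; rewrite ?E e1 y12 y10 ?simpr => Q.
  by apply: (double_inj two); apply: (eq_comb (-1) Q); ring.
have [h0|h0] := eqVneq (y 2 1)%N 0; last first.
  have y12 : (y 1 2)%N = 0.
    by move/eqP: fh; rewrite mulf_eq0 (negPf h0) => /eqP.
  entry B (1, 1)%N; rewrite ?E e1 y12 b0 ?simpr => Q.
  have /eqP : (1 : F) = 0 by apply: (double_inj two); apply: (eq_comb 1 Q); ring.
  by rewrite oner_eq0.
have df : (y 1 2)%N * (y 1 0)%N = 1.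
  entry B (1, 1)%N; rewrite ?E e1 h0 b0 ?simpr => Q.
  by apply: (double_inj two); apply: (eq_comb (-1) Q); ring.
have f0 : (y 1 2)%N != 0.
  by apply: contra_eq_neq df => ->; rewrite mul0r eq_sym oner_eq0.
exists (y 1 2)%N => //; apply: Or43; rewrite /is_N3 /entries ?E e1 h0 b0.
by congr (_, _, _, _, _, _, _, _, _); apply: (mulfI f0); rewrite mulfV.
Qed.

(** * Involutions [M] compatible with each [N] *)

Variant inv2_spec (e f h k : F) : Prop :=
| Inv2Lower of h != 0 & k = - e & f = (1 - e ^+ 2) / h
| Inv2One of e = 1 & f = 0 & h = 0 & k = 1
| Inv2Opp of e = -1 & f = 0 & h = 0 & k = -1
| Inv2OneOpp of e = 1 & h = 0 & k = -1
| Inv2OppOne of e = -1 & h = 0 & k = 1.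

(** If [h] is nonzero, it determines [k] and [f] from [e]. If [h = 0], the diagonal entries are
    signs, and [f (e + k) = 0] leaves [f] free only for opposite signs. *)
Lemma inv2P (e f h k : F) : 2 != 0 :> F ->
  e * e + f * h = 1 -> e * f + f * k = 0 -> h * e + k * h = 0 -> h * f + k * k = 1 ->
  inv2_spec e f h k.
Proof.
move=> two I11 I12 I21 I22.
have [h0|h0] := eqVneq h 0; last first.
  apply: Inv2Lower => //.
    have : h * (k + e) = 0 by rewrite -I21; ring.
    by move/eqP; rewrite mulf_eq0 (negPf h0) addr_eq0 => /eqP.
  by apply: (mulIf h0); rewrite mulfVK // -I11; ring.
have f0 : e + k != 0 -> f = 0.
  move=> ek; have : f * (e + k) = 0 by rewrite -I12; ring.
  by move/eqP; rewrite mulf_eq0 (negPf ek) orbF => /eqP.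
have /eqP := I11; rewrite h0 mulr0 addr0 -expr2 sqrf_eq1.
have /eqP := I22; rewrite h0 mul0r add0r -expr2 sqrf_eq1.
case/orP=> /eqP k1 /orP[] /eqP e1.
- by apply: Inv2One => //; apply: f0; rewrite e1 k1.
- exact: Inv2OppOne.
- exact: Inv2OneOpp.
- by apply: Inv2Opp => //; apply: f0; rewrite e1 k1 -opprD oppr_eq0.
Qed.

(** With [N] trivial, the mixed relation equates the embeddings of [x] at positions 1 and 2. Row 0
    and column 0 are therefore trivial, and the other entries follow down the diagonals. *)
Lemma mixed_I x y : is_I y -> mixed x y -> is_I x.
Proof.
case=> y00 y01 y02 y10 y11 y12 y20 y21 y22 X.
have E := (y00, y01, y02, y10, y11, y12, y20, y21, y22, simpr).
have x00 : (x 0 0)%N = 1 by entry X (0, 0)%N; rewrite ?E.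
have x01 : (x 0 1)%N = 0 by entry X (0, 1)%N; rewrite ?E.
have x02 : (x 0 2)%N = 0 by entry X (0, 2)%N; rewrite ?E.
have x10 : (x 1 0)%N = 0 by entry X (1, 0)%N; rewrite ?E.
have x20 : (x 2 0)%N = 0 by entry X (2, 0)%N; rewrite ?E.
have x11 : (x 1 1)%N = 1 by entry X (1, 1)%N; rewrite ?E x00.
have x12 : (x 1 2)%N = 0 by entry X (1, 2)%N; rewrite ?E x01.
have x21 : (x 2 1)%N = 0 by entry X (2, 1)%N; rewrite ?E x10.
have x22 : (x 2 2)%N = 1 by entry X (2, 2)%N; rewrite ?E x11.
by rewrite /is_I /entries x00 x01 x02 x10 x11 x12 x20 x21 x22.
Qed.

(** The nonzero entries (1, 2) and (2, 1) of [y] make row 0 and column 0 of [x] trivial, so [inv2P]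
    applies to the rest. *)
Lemma involution_with_N1 x y p : 2 != 0 :> F -> p != 0 -> is_N1 y p -> commutes_far y x ->
  involutive_loc x ->
  exists e f h k, entries x = (1, 0, 0, 0, e, f, 0, h, k) /\ inv2_spec e f h k.
Proof.
move=> two p0 [_ _ _ _ _ y12 _ y21 _] H I.
have y12N : (y 1 2)%N != 0 by rewrite y12.
have y21N : (y 2 1)%N != 0 by rewrite y21 invr_eq0.
have r j : (j < 3)%N -> x 0%N j = (j == 0%N)%:R.
  by move=> hj; case: (far_row H (i := 1%N) (j := j)) => //= /eqP; rewrite (negPf y12N).
have c j : (j < 3)%N -> x j 0%N = (j == 0%N)%:R.
  by move=> hj; case: (far_col H (i := 1%N) (j := j)) => //= /eqP; rewrite (negPf y21N).
have E := (r 0%N isT, r 1%N isT, r 2%N isT, c 1%N isT, c 2%N isT).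
exists (x 1 1)%N, (x 1 2)%N, (x 2 1)%N, (x 2 2)%N; split; first by rewrite /entries !E.
apply: inv2P => //.
- by entry I (1, 1)%N; rewrite !E ?simpr.
- by entry I (1, 2)%N; rewrite !E ?simpr.
- by entry I (2, 1)%N; rewrite !E ?simpr.
- by entry I (2, 2)%N; rewrite !E ?simpr.
Qed.

Lemma involution_with_N2 x y p : 2 != 0 :> F -> p != 0 -> is_N2 y p -> commutes_far x y ->
  involutive_loc x ->
  exists e f h k, entries x = (e, f, 0, h, k, 0, 0, 0, 1) /\ inv2_spec e f h k.
Proof.
move=> two p0 [_ y01 _ y10 _ _ _ _ _] H I.
have y01N : (y 0 1)%N != 0 by rewrite y01.
have y10N : (y 1 0)%N != 0 by rewrite y10 invr_eq0.
have r i : (i < 3)%N -> x i 2%N = (i == 2%N)%:R.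
  by move=> hi; case: (far_row H (i := i) (j := 1%N)) => //= [|/eqP];
    [case: i hi => [|[|[]]] | rewrite (negPf y01N)].
have c i : (i < 3)%N -> x 2%N i = (i == 2%N)%:R.
  by move=> hi; case: (far_col H (i := i) (j := 1%N)) => //= [|/eqP];
    [case: i hi => [|[|[]]] | rewrite (negPf y10N)].
have E := (r 0%N isT, r 1%N isT, r 2%N isT, c 0%N isT, c 1%N isT).
exists (x 0 0)%N, (x 0 1)%N, (x 1 0)%N, (x 1 1)%N; split; first by rewrite /entries !E.
apply: inv2P => //.
- by entry I (0, 0)%N; rewrite !E ?simpr.
- by entry I (0, 1)%N; rewrite !E ?simpr.
- by entry I (1, 0)%N; rewrite !E ?simpr.
- by entry I (1, 1)%N; rewrite !E ?simpr.
Qed.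

(** The nonzero entries (1, 2) and (1, 0) of [y] make rows 0 and 2 of [x] trivial. The middle entry
    is then a sign, and the mixed relation ties its two neighbours together when it is -1. *)
Lemma involution_with_N3 x y p : 2 != 0 :> F -> p != 0 -> is_N3 y p ->
  commutes_far x y -> commutes_far y x -> involutive_loc x -> mixed x y ->
  is_I x \/ exists d, entries x = (1, 0, 0, d, -1, 2 * p - d * p ^+ 2, 0, 0, 1).
Proof.
move=> two p0 [y00 y01 y02 y10 y11 y12 y20 y21 y22] H H' I X.
have y12N : (y 1 2)%N != 0 by rewrite y12.
have y10N : (y 1 0)%N != 0 by rewrite y10 invr_eq0.
have r j : (j < 3)%N -> x 0%N j = (j == 0%N)%:R.
  by move=> hj; case: (far_row H' (i := 1%N) (j := j)) => //= /eqP; rewrite (negPf y12N).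
have c i : (i < 3)%N -> x 2%N i = (i == 2%N)%:R.
  by move=> hi; case: (far_col H (i := i) (j := 1%N)) => //= [|/eqP];
    [case: i hi => [|[|[]]] | rewrite (negPf y10N)].
have E := (r 0%N isT, r 1%N isT, r 2%N isT, c 0%N isT, c 1%N isT, c 2%N isT).
have /eqP : (x 1 1)%N * (x 1 1)%N = 1 by entry I (1, 1)%N; rewrite !E ?simpr.
rewrite -expr2 sqrf_eq1 => /orP[] /eqP e1.
  have x10 : (x 1 0)%N = 0 by apply: (double_eq0 two); entry I (1, 0)%N; rewrite !E e1 ?simpr.
  have x12 : (x 1 2)%N = 0 by apply: (double_eq0 two); entry I (1, 2)%N; rewrite !E e1 ?simpr.
  by left; rewrite /is_I /entries !E e1 x10 x12.
right; exists (x 1 0)%N; rewrite /entries !E e1.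
congr (_, _, _, _, _, _, _, _, _).
(* With d and f the entries (1, 0) and (1, 2) of [x], this entry reads f / p - 1 = 1 - d p. *)
entry X (2, 2)%N; rewrite ?(E, e1, y00, y01, y02, y10, y11, y12, y20, y21, y22, simpr) => Q.
by apply: (eq_comb p Q); field.
Qed.

(** The transposed situation: columns 0 and 2 of [x] are trivial. *)
Lemma involution_with_N4 x y p : 2 != 0 :> F -> p != 0 -> is_N4 y p ->
  commutes_far x y -> commutes_far y x -> involutive_loc x -> mixed x y ->
  is_I x \/ exists h, entries x = (1, 2 * p - h * p ^+ 2, 0, 0, -1, 0, 0, h, 1).
Proof.
move=> two p0 [y00 y01 y02 y10 y11 y12 y20 y21 y22] H H' I X.
have y01N : (y 0 1)%N != 0 by rewrite y01.
have y21N : (y 2 1)%N != 0 by rewrite y21 invr_eq0.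
have r i : (i < 3)%N -> x i 2%N = (i == 2%N)%:R.
  by move=> hi; case: (far_row H (i := i) (j := 1%N)) => //= [|/eqP];
    [case: i hi => [|[|[]]] | rewrite (negPf y01N)].
have c j : (j < 3)%N -> x j 0%N = (j == 0%N)%:R.
  by move=> hj; case: (far_col H' (i := 1%N) (j := j)) => //= /eqP; rewrite (negPf y21N).
have E := (r 0%N isT, r 1%N isT, r 2%N isT, c 0%N isT, c 1%N isT, c 2%N isT).
have /eqP : (x 1 1)%N * (x 1 1)%N = 1 by entry I (1, 1)%N; rewrite !E ?simpr.
rewrite -expr2 sqrf_eq1 => /orP[] /eqP e1.
  have x01 : (x 0 1)%N = 0 by apply: (double_eq0 two); entry I (0, 1)%N; rewrite !E e1 ?simpr.
  have x21 : (x 2 1)%N = 0 by apply: (double_eq0 two); entry I (2, 1)%N; rewrite !E e1 ?simpr.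
  by left; rewrite /is_I /entries !E e1 x01 x21.
right; exists (x 2 1)%N; rewrite /entries !E e1.
congr (_, _, _, _, _, _, _, _, _).
(* With b and h the entries (0, 1) and (2, 1) of [x], this entry reads b - p + h p^2 = p. *)
entry X (0, 1)%N; rewrite ?(E, e1, y00, y01, y02, y10, y11, y12, y20, y21, y22, simpr) => Q.
by apply: (eq_comb 1 Q); field.
Qed.
End Algebra.

(** * From matrices of size n + 1 to their corners *)

Definition nentry (X : 'M[C]_3) (a b : nat) : C := X (inord a) (inord b).

Lemma localmxE n i X (a b : 'I_n.+1) : localmx n i X a b = nloc i (nentry X) a b.
Proof. by rewrite mxE. Qed.

Lemma mx3_entries X a b c d e f g h k :
  entries (nentry X) = (a, b, c, d, e, f, g, h, k) -> X = mx3 a b c d e f g h k.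
Proof.
case=> <- <- <- <- <- <- <- <- <-; apply/matrixP=> i j; rewrite mxE /nentry.
by case: i j => [[|[|[|//]]] hi] [[|[|[|//]]] hj] /=; congr (X _ _); apply: val_inj;
  rewrite /= inordK.
Qed.

(* The vanishing of the entries to the right of the corner makes corners multiplicative. *)
Definition corner5 n (A : 'M[C]_n.+1) (x : nat -> nat -> C) :=
  (forall a b : 'I_n.+1, (a < 5)%N -> (b < 5)%N -> A a b = x a b) /\
  (forall a b : 'I_n.+1, (a < 5 <= b)%N -> A a b = 0).

Lemma corner5_loc n i X : (0 < i < 4)%N -> corner5 (localmx n i X) (nloc i (nentry X)).
Proof.
move=> hi; split=> a b ha; first by move=> hb; rewrite localmxE.
rewrite localmxE /nloc ifF; last by apply/negP; lia.
by rewrite [_ == _]negbTE //; lia.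
Qed.

Lemma corner5_mul n (A B : 'M[C]_n.+1) x y : (4 <= n)%N ->
  corner5 A x -> corner5 B y -> corner5 (A *m B) (nmul x y).
Proof.
case: n A B => [|[|[|[|n]]]] // A B _ [A1 A0] [B1 B0]; split=> a b.
  move=> ha hb; rewrite mxE /nmul.
  (* The first five terms are those of [nmul]; the later ones meet the zeros of [A] to the right of
     its corner. *)
  rewrite 5!big_ord_recl big1 ?addr0; last by move=> k _; rewrite A0 ?mul0r // ha.
  by rewrite !A1 ?B1 //= !addrA.
move=> /andP[ha hb]; rewrite mxE big1 // => k _.
have [k5|k5] := ltnP k 5; first by rewrite [B k b]B0 ?mulr0 // k5 hb.
by rewrite A0 ?mul0r // ha.
Qed.

Lemma corner5_eq n (A B : 'M[C]_n.+1) x y : (4 <= n)%N -> A = B ->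
  corner5 A x -> corner5 B y -> eq5 x y.
Proof.
move=> hn <- [A1 _] [B1 _] a b ha hb.
have a' : (a < n.+1)%N by apply: leq_trans ha _.
have b' : (b < n.+1)%N by apply: leq_trans hb _.
by rewrite -[x a b](A1 (Ordinal a') (Ordinal b')) // B1.
Qed.

Lemma corner5_1 n : corner5 (1%:M : 'M[C]_n.+1) (fun a b => (a == b)%:R).
Proof.
split=> a b ha; first by rewrite mxE.
by rewrite mxE [_ == _]negbTE //; apply/eqP => ab; move: ha; rewrite ab; lia.
Qed.

Lemma nentry_mx3 a b c d e f g h k (u v : nat) : (u < 3)%N -> (v < 3)%N ->
  nentry (mx3 a b c d e f g h k) u v =
  nth 0 (nth [::] [:: [:: a; b; c]; [:: d; e; f]; [:: g; h; k]] u) v.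
Proof. by move=> hu hv; rewrite /nentry mxE !inordK. Qed.

(** * Conjugation by the cyclic shift *)

Definition nblock2 (i : nat) (e f h k : C) (a b : nat) : C :=
  if (i <= a < i.+2)%N && (i <= b < i.+2)%N
  then nth 0 (nth [::] [:: [:: e; f]; [:: h; k]] (a - i)) (b - i)
  else (a == b)%:R.

Lemma nat_window (j a : nat) : (j <= a < j.+3)%N -> exists2 u, (u < 3)%N & a = (j + u)%N.
Proof. by move=> ja; exists (a - j)%N; lia. Qed.

(** Together with [nloc_upper], this shows that the two kinds of local matrix are the same 2x2
    block, at starting indices [i] and [i.-1]. *)
Lemma nloc_lower i e f h k (a b : nat) : (0 < i)%N ->
  nloc i (nentry (mx3 1 0 0 0 e f 0 h k)) a b = nblock2 i e f h k a b.
Proof.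
case: i => // j _; rewrite /nloc /nblock2 /=.
have [/andP[ja jb]|nab] := boolP (_ && _); last by rewrite ifF //; lia.
have [u hu ->] := nat_window ja; have [v hv ->] := nat_window jb.
rewrite !addKn nentry_mx3 // eqn_add2l -addn1 -addn2.
case: u v hu hv {ja jb} => [|[|[|//]]] [|[|[|//]]] _ _;
  rewrite ?leq_add2l ?ltn_add2l ?subnDl ?addn1 ?addn2 //=;
  by rewrite ?(andbF, ltnS, leqnn, leqnSn).
Qed.

Lemma nloc_upper i e f h k (a b : nat) : (0 < i)%N ->
  nloc i (nentry (mx3 e f 0 h k 0 0 0 1)) a b = nblock2 i.-1 e f h k a b.
Proof.
case: i => // j _; rewrite /nloc /nblock2 /=.
have [/andP[ja jb]|nab] := boolP (_ && _); last by rewrite ifF //; lia.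
have [u hu ->] := nat_window ja; have [v hv ->] := nat_window jb.
rewrite !addKn nentry_mx3 // eqn_add2l -addn2 !leq_addr /= !ltn_add2l.
by case: u v hu hv {ja jb} => [|[|[|//]]] [|[|[|//]]] _ _.
Qed.

Definition shift_perm n : {perm 'I_n.+1} := perm (@ordS_inj n.+1).

(** Conjugation by [P] reads the entry (a + 1, b + 1) modulo n + 1 at (a, b), lowering the block by
    one index for all [i] at once. The wrap from n to 0 is harmless: the old block avoids index 0
    and the new one avoids n. *)
Lemma localmx_shift n i (e f h k : C) : (1 <= i <= n.-1)%N ->
  let P := perm_mx (shift_perm n) in
  P *m localmx n i (mx3 1 0 0 0 e f 0 h k) *m invmx P =
  localmx n i (mx3 e f 0 h k 0 0 0 1).
Proof.
move=> hi P.
have -> : invmx P = perm_mx (shift_perm n)^-1.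
  have uP : P \in unitmx by apply: unitmx_perm.
  apply: (can_inj (mulKmx uP)); rewrite mulmxV //.
  by rewrite -perm_mxM mulgV perm_mx1.
have i0 : (0 < i)%N by case/andP: hi.
rewrite -row_permE -col_permE; apply/matrixP=> a b.
rewrite mxE mxE !localmxE nloc_lower // nloc_upper // /nblock2 !permE /=.
have sE (c : 'I_n.+1) : (c.+1 %% n.+1)%N = if c == n :> nat then 0%N else c.+1.
  case: eqP => [->|/eqP cn]; first by rewrite modnn.
  by rewrite modn_small // ltnS ltn_neqAle cn -ltnS ltn_ord.
rewrite !sE; move: (ltn_ord a) (ltn_ord b) hi => {sE}.
move: (nat_of_ord a) (nat_of_ord b) => {}a {}b ha hb hi.
case: i hi i0 => // i hi _ /=.
case: eqP => [->|an]; case: eqP => [->|bn].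
- by rewrite ifF ?ifF ?eqxx //; lia.
- by rewrite ifF ?ifF //; [congr (nat_of_bool _)%:R|..]; lia.
- by rewrite ifF ?ifF //; [congr (nat_of_bool _)%:R|..]; lia.
- by rewrite !subSS eqSS.
Qed.

(** * Assembly of the fourteen families *)

Lemma VT_rep_local_relations n M N (x := nentry M) (y := nentry N) :
  (4 <= n)%N -> VT_rep_relations n M N ->
  [/\ involutive_loc x, braid y, commutes_far y y & involutive_loc y] /\
  [/\ commutes_far x y, commutes_far y x & mixed x y].
Proof.
move=> hn [SS [_ [PPP [PPf [PP [SPf mix]]]]]].
have r1 : (1 <= 1 <= n.-1)%N by lia.
(* Here [4 <= n] provides the generators at position 3. *)
have r3 : (1 <= 3 <= n.-1)%N by lia.
have r1' : (1 <= 1 <= n - 2)%N by lia.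
have L X i : (0 < i < 4)%N -> corner5 (localmx n i X) (nloc i (nentry X)).
  exact: corner5_loc.
split; split.
- apply: (corner5_eq hn (SS 1%N r1)); last exact: corner5_1.
  by apply: corner5_mul => //; exact: L.
- by apply: (corner5_eq hn (PPP 1%N r1')); do 2?[apply: corner5_mul => //]; exact: L.
- by apply: (corner5_eq hn (PPf 1%N 3%N r1 r3 isT)); apply: corner5_mul => //; exact: L.
- apply: (corner5_eq hn (PP 1%N r1)); last exact: corner5_1.
  by apply: corner5_mul => //; exact: L.
- by apply: (corner5_eq hn (SPf 1%N 3%N r1 r3 isT)); apply: corner5_mul => //; exact: L.
(* The far relation at (3, 1), read backwards, puts [N] at position 1 and [M] at position 3. *)
- by apply: (corner5_eq hn (esym (SPf 3%N 1%N r3 r1 isT))); apply: corner5_mul => //; exact: L.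
- by apply: (corner5_eq hn (mix 1%N r1')); do 2?[apply: corner5_mul => //]; exact: L.
Qed.

Theorem theorem4p1 (n : nat) (M N : 'M[C]_3) :
  (4 <= n)%N ->
  homogeneous_3_local_rep n M N ->
  exists (M' N' : 'M[C]_3) (P : 'M[C]_(n.+1)),
    [/\ delta_family M' N', P \in unitmx,
        (forall i, (1 <= i <= n.-1)%N ->
           P *m localmx n i M *m invmx P = localmx n i M') &
        (forall i, (1 <= i <= n.-1)%N ->
           P *m localmx n i N *m invmx P = localmx n i N')].
Proof.
match goal with |- _ -> _ -> ?G => set concl := G end.
move=> hn [_ [_ /(VT_rep_local_relations hn)[]]].
case=> Ix By Fyy Iy [Fxy Fyx X].
have two : 2 != 0 :> C by rewrite pnatr_eq0.
have conj1 : delta_family M N -> concl.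
  move=> D; exists M, N, 1%:M.
  by split=> // [|i _|i _]; rewrite ?unitmx1 // mul1mx invmx1 mulmx1.
have [yI|[p p0 yN]] := braid_classification two Fyy Iy By.
  apply: conj1; do 13!right.
  by split; apply: mx3_entries; last exact: yI; exact: mixed_I yI X.
case: yN => yN; have NE := mx3_entries yN.
- have [e [f [h [k [/mx3_entries ME]]]]] := involution_with_N1 two p0 yN Fyx Ix.
  (* The shift carries [N1 p] to [N2 p] and moves the block of [M] along with it. *)
  have shifted : delta_family (mx3 e f 0 h k 0 0 0 1) (N2 p) -> concl.
    move=> D; exists (mx3 e f 0 h k 0 0 0 1), (N2 p), (perm_mx (shift_perm n)).
    split=> // [|i hi|i hi]; first exact: unitmx_perm.
      by rewrite ME; apply: localmx_shift.
    by rewrite NE; apply: localmx_shift.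
  (* In order: families 1, 11, 9, then 5 and 6 after the shift. *)
  case=> [h0 kE fE|eE fE hE kE|eE fE hE kE|eE hE kE|eE hE kE].
  + by apply: conj1; left; exists e, h, p; split=> //; rewrite ME kE fE.
  + by apply: conj1; do 10!right; left; exists p; split=> //; rewrite ME eE fE hE kE.
  + by apply: conj1; do 8!right; left; exists p; split=> //; rewrite ME eE fE hE kE.
  + by apply: shifted; do 4!right; left; exists f, p; split=> //; rewrite eE hE kE.
  + by apply: shifted; do 5!right; left; exists f, p; split=> //; rewrite eE hE kE.
- have [e [f [h [k [/mx3_entries ME]]]]] := involution_with_N2 two p0 yN Fxy Ix.
  (* In order: families 2, 13, 12, 5, 6. *)
  case=> [h0 kE fE|eE fE hE kE|eE fE hE kE|eE hE kE|eE hE kE]; apply: conj1.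
  (* [M2] carries its parameter negated in the top left corner, hence the witness [- e]. *)
  + right; left; exists (- e), h, p; split=> //.
    by rewrite /M2 ME kE fE opprK sqrrN.
  + by do 12!right; left; exists p; split=> //; rewrite ME eE fE hE kE.
  + by do 11!right; left; exists p; split=> //; rewrite ME eE fE hE kE.
  + by do 4!right; left; exists f, p; split=> //; rewrite ME eE hE kE.
  + by do 5!right; left; exists f, p; split=> //; rewrite ME eE hE kE.
- apply: conj1; have [/mx3_entries ME|[d /mx3_entries ME]] := involution_with_N3 two p0 yN Fxy Fyx Ix X.
    by do 6!right; left; exists p.
  by do 2!right; left; exists d, p.
- apply: conj1; have [/mx3_entries ME|[h /mx3_entries ME]] := involution_with_N4 two p0 yN Fxy Fyx Ix X.
    by do 7!right; left; exists p.
  by do 3!right; left; exists h, p.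
Qed.
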